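(* Let $\mathbf{K}$ and $\mathbf{C}$ be convex bodies in $\mathbb{E}^d$, $d\ge 2$, and let $m$ be a positive integer. If $\mathbf{V}_1\cup\mathbf{V}_2\cup\dots\cup\mathbf{V}_n$ is an inductive partition of $\mathbb{E}^d$ such that ${\rm int}(\mathbf{V}_i\cap\mathbf{K})\neq\emptyset$ for all $1\le i\le n$, then $$\sum_{i=1}^{n}r_{\mathbf{C}}(\mathbf{V}_i\cap\mathbf{K}, m)\ge r_{\mathbf{C}}(\mathbf{K} , m).$$
   Context: $\mathbb{E}^d$ is $d$-dimensional Euclidean space. A convex body is a compact convex set with non-empty interior. For a convex body $\mathbf{C}$ and a hyperplane $H$, $w(\mathbf{C},H)$ is the distance between the two supporting hyperplanes of $\mathbf{C}$ parallel to $H$. For convex bodies $\mathbf{C},\mathbf{K}$ the $\mathbf{C}$-width of $\mathbf{K}$ parallel to $H$ is $w_{\mathbf{C}}(\mathbf{K},H)=w(\mathbf{K},H)/w(\mathbf{C},H)$, and the minimal $\mathbf{C}$-width of $\mathbf{K}$ is $w_{\mathbf{C}}(\mathbf{K})=\min_H w_{\mathbf{C}}(\mathbf{K},H)$ over all hyperplanes $H$ of $\mathbb{E}^d$. The $\mathbf{C}$-inradius of $\mathbf{K}$ is the largest $r>0$ such that some translate of $r\mathbf{C}$ is contained in $\mathbf{K}$. For $0<\rho\le r$ (with $r$ the $\mathbf{C}$-inradius of $\mathbf{K}$), the $\rho\mathbf{C}$-rounded body $\mathbf{K}^{\rho\mathbf{C}}$ of $\mathbf{K}$ is the union of all translates of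 $\rho\mathbf{C}$ contained in $\mathbf{K}$. For an integer $m\ge1$, the $m$th successive $\mathbf{C}$-inradius of $\mathbf{K}$, denoted $r_{\mathbf{C}}(\mathbf{K},m)$, is the uniquely determined $\rho\in(0,r]$ with $w_{\mathbf{C}}(\mathbf{K}^{\rho\mathbf{C}})=m\rho$. A convex partition $\mathbf{V}_1\cup\dots\cup\mathbf{V}_n$ of $\mathbb{E}^d$ is a family $\mathbf{V}_1,\dots,\mathbf{V}_n$ of closed convex sets having pairwise disjoint non-empty interiors with $\mathbf{V}_1\cup\dots\cup\mathbf{V}_n=\mathbb{E}^d$. Inductive partitions are defined recursively on the number of parts: the partition into one part $\mathbf{V}_1=\mathbb{E}^d$ is inductive; for $n\ge2$, a convex partition $\mathbf{V}_1\cup\dots\cup\mathbf{V}_n$ of $\mathbb{E}^d$ is inductive if for every $1\le i\le n$ there exists an inductive partition $\mathbf{W}_1\cup\dots\cup\mathbf{W}_{i-1}\cup\mathbf{W}_{i+1}\cup\dots\cup\mathbf{W}_n$ of $\mathbb{E}^d$ (into $n-1$ parts) such that $\mathbf{V}_j\subset\mathbf{W}_j$ for all $j\ne i$. *)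

(* Defs.v *)
From mathcomp Require Import all_boot all_order all_algebra.
From mathcomp Require Import all_classical all_reals all_analysis.

Set Implicit Arguments.
Unset Strict Implicit.
Unset Printing Implicit Defensive.

Import Order.TTheory GRing.Theory Num.Theory.
Import numFieldNormedType.Exports.

Local Open Scope classical_set_scope.
Local Open Scope ring_scope.

(* Euclidean d-space is 'rV[R]_d. The library's norm on 'rV[R]_d is the sup
   norm: it gives the Euclidean topology, so the library's compact, closed and
   interior are used, but distances go through the dot product below. *)

Section Definitions.
Variables (R : realType) (d : nat).
Local Notation E := 'rV[R]_d.
Implicit Types (A B C K H : set E).

Definition dot (u x : E) : R := (u *m x^T) 0 0.

Definition enorm (x : E) : R := Num.sqrt (dot x x).

Definition set_dist A B : R := inf [set enorm (x - y) | x in A & y in B].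

Definition convex_body C : Prop := [/\ compact C, convex_set C & C° !=set0].

Definition hyperplane (u : E) (c : R) : set E := [set x | dot u x = c].

Definition is_hyperplane H : Prop :=
  exists u c, u != 0 /\ H = hyperplane u c.

Definition parallel H1 H2 : Prop := exists t : E, H2 = [set t + x | x in H1].

Definition supporting C H : Prop :=
  C `&` H !=set0 /\
  exists u c, [/\ u != 0, H = hyperplane u c & forall x, C x -> dot u x <= c].

(* If C is a convex body and H a hyperplane, C has exactly two supporting
   hyperplanes parallel to H, so the value chosen is uniquely determined. *)
Definition width C H : R :=
  xget 0 [set w | exists H1 H2,
    [/\ supporting C H1 /\ parallel H H1, supporting C H2 /\ parallel H H2,
        H1 <> H2 & w = set_dist H1 H2]].

Definition rel_width C K H : R := width K H / width C H.

(* For convex bodies this infimum is attained. *)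
Definition min_rel_width C K : R :=
  inf [set rel_width C K H | H in is_hyperplane].

Definition homothet (t : E) (rho : R) C : set E := [set t + rho *: x | x in C].

(* For convex bodies this supremum is attained. *)
Definition inradius C K : R :=
  sup [set r | 0 < r /\ exists t, homothet t r C `<=` K].

Definition rounded_body C (rho : R) K : set E :=
  \bigcup_(t in [set t | homothet t rho C `<=` K]) homothet t rho C.

(* For convex bodies C and K and m >= 1 there is exactly one such rho; the
   default value 0 of xget is only a junk value. *)
Definition succ_inradius C K (m : nat) : R :=
  xget 0 [set rho | 0 < rho <= inradius C K /\
                    min_rel_width C (rounded_body C rho K) = m%:R * rho].

Definition convex_partition n (V : 'I_n -> set E) : Prop :=
  [/\ forall i, closed (V i) /\ convex_set (V i),
      forall i, (V i)° !=set0,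
      trivIset setT (fun i => (V i)°) &
      \bigcup_i V i = setT].

(* The family has n.+1 parts. Removing the part i from n'.+2 parts leaves the
   parts lift i j, with j : 'I_n'.+1. *)
Fixpoint inductive_partition (n : nat) : ('I_n.+1 -> set E) -> Prop :=
  match n with
  | 0 => fun V => V ord0 = setT
  | n'.+1 => fun V => convex_partition V /\
      forall i, exists W : 'I_n'.+1 -> set E,
        inductive_partition W /\ forall j, V (lift i j) `<=` W j
  end.

End Definitions.

(* Main.v *)
(* Write s(A) for the largest r >= 0 such that [A ⊖ rC = {t : t + rC ⊂ A}] is
   nonempty and of minimal C-width at least (m - 1) r. For a convex body A this
   is the m-th successive C-inradius, but s also makes sense, and is >= 0, for
   degenerate A, and it is concave under Minkowski combinations and invariant
   under translations.

   The inequality [s(K) <= Σ_i s(V_i ∩ K)] then holds without any condition on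
   interiors, by induction on the number of parts. If some [V_i ∩ K] has empty
   interior, the part i is dropped using the smaller partition W, since then
   [s(W_j ∩ K) <= s(V_j ∩ K)] for the other j. Otherwise let K move along a line
   [K + t w] on which it eventually leaves V_0. The sum
   [F(t) = Σ_i s(V_i ∩ (K + t w))] is concave between consecutive times at which
   some intersection has empty interior, is >= s(K) at those times by the
   previous case, and is >= 0 everywhere. There is such a time after 0, and
   either there is one before 0, or F is concave and bounded below on a half
   line towards -∞; both give F(0) >= s(K). *)
Require Import Defs.
From mathcomp Require Import all_boot all_order all_algebra.
From mathcomp Require Import all_classical all_reals all_analysis.
From mathcomp Require Import ring lra.

Import Order.TTheory GRing.Theory Num.Theory.
Import numFieldNormedType.Exports.

Local Open Scope classical_set_scope.
Local Open Scope ring_scope.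

(** * Concave functions on the line with exceptional times *)

Section ConcaveCrossing.
Context {R : realType}.

Lemma closed_first (B : set R) (b : R) : closed B -> B b -> 0 < b -> ~ B 0 ->
  exists T, [/\ 0 < T, B T & forall t, 0 <= t < T -> ~ B t].
Proof.
move=> clB Bb b0 nB0.
have cS : compact (B `&` `[0, b]%classic).
  by rewrite setIC; apply: compact_closedI => //; exact: segment_compact.
have neS : B `&` `[0, b]%classic !=set0.
  by exists b; split => //=; rewrite in_itv/= lexx ltW.
have [|T] := compact_EVT_min (f := @idfun R) neS cS.
  by apply: continuous_subspaceT => x; exact: cvg_id.
rewrite inE /= in_itv /= => -[BT /andP[T0 Tb]] minT.
exists T; split => //.
  by rewrite lt_neqAle T0 andbT; apply/eqP => T0'; apply: nB0; rewrite T0'.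
move=> t /andP[t0 tT] Bt; have := minT t; rewrite inE /= in_itv /= t0.
by rewrite (le_trans (ltW tT) Tb) => /(_ (conj Bt isT)); rewrite leNgt tT.
Qed.

(** Concavity is assumed up to the endpoints [a] and [b], even if they lie in [B], so it can be used
    between the elements of [B] nearest to 0. *)
Lemma concave_crossing (B : set R) (F : R -> R) (s : R) :
  closed B -> (forall t, 0 <= F t) -> (forall t, B t -> s <= F t) ->
  (forall a b l, a < b -> 0 <= l <= 1 -> (forall t, a < t < b -> ~ B t) ->
     (1 - l) * F a + l * F b <= F ((1 - l) * a + l * b)) ->
  (exists2 b, 0 < b & B b) -> s <= F 0.
Proof.
move=> clB F0 sF concF [b b0 Bb].
have [B0|nB0] := pselect (B 0); first exact: sF.
have [T [T0 BT nBT]] := closed_first B b clB Bb b0 nB0.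
(* Concavity on [[a, T]] read at 0, where [T] has weight [- a / (T - a)], multiplied by [T - a] and
   with [F T] bounded below by [s]. *)
have through a : a < 0 -> (forall t, a < t < 0 -> ~ B t) ->
    T * F a - a * s <= (T - a) * F 0.
  move=> a0 nBa; have Ta : 0 < T - a by rewrite subr_gt0 (lt_trans a0).
  have := concF a T (- a / (T - a)).
  have -> : (1 - - a / (T - a)) * a + - a / (T - a) * T = 0.
    by field; rewrite gt_eqF.
  have -> : (1 - - a / (T - a)) = T / (T - a) by field; rewrite gt_eqF.
  have l01 : 0 <= - a / (T - a) <= 1.
    rewrite divr_ge0 ?oppr_ge0 ?(ltW a0) ?(ltW Ta)//=.
    by rewrite ler_pdivrMr// mul1r; move: T0; lra.
  move/(_ (lt_trans a0 T0) l01); have nB : forall t, a < t < T -> ~ B t.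
    move=> t /andP[ta tT]; case: (ltP t 0) => t0; first by apply: nBa; rewrite ta.
    by apply: nBT; rewrite t0.
  move/(_ nB) => H; have sT := sF _ BT.
  apply: (@le_trans _ _ ((T - a) * (T / (T - a) * F a + - a / (T - a) * F T))).
    have -> : (T - a) * (T / (T - a) * F a + - a / (T - a) * F T) =
        T * F a - a * F T by field; rewrite gt_eqF.
    by rewrite lerD2l -!mulNr ler_wpM2l// oppr_ge0 ltW.
  by rewrite ler_wpM2l// ltW.
have [[a Ba a0]|nBn] := pselect (exists2 a, B a & a < 0).
  (* Reflection turns the last element of [B] before 0 into a first one after 0. *)
  have clNB : closed [set t | B (- t)].
    by apply: (@preimage_closed _ _ -%R B) => //; move=> x _; exact: opp_continuous.
  have [|||T' [T'0 BT' nBT']] := closed_first [set t | B (- t)] (- a) clNB.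
  - by rewrite /= opprK.
  - by rewrite oppr_gt0.
  - by rewrite /= oppr0.
  have := through (- T'); rewrite oppr_lt0 => /(_ T'0).
  have nB : forall t, - T' < t < 0 -> ~ B t.
    move=> t /andP[t1 t2]; have := nBT' (- t); rewrite /= opprK; apply.
    by rewrite oppr_ge0 ltW//= ltrNl.
  move/(_ nB); have := sF _ BT'; nra.
(* No bad time before 0: let a -> -oo, using only F a >= 0. *)
rewrite leNgt; apply/negP => Fs.
have s0 : 0 < s - F 0 by rewrite subr_gt0.
(* For this [a], [- a * (s - F 0)] exceeds [T * F 0], whereas [through] and [F a >= 0] bound it by
   [T * F 0]. *)
pose a := - (T * F 0 / (s - F 0) + 1).
have a0 : a < 0.
  by rewrite oppr_lt0 ltr_wpDl// divr_ge0 ?mulr_ge0// ltW.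
have nB : forall t, a < t < 0 -> ~ B t.
  by move=> t /andP[_ t0] Bt; apply: nBn; exists t.
have := through a a0 nB; rewrite leNgt => /negP; apply.
have -> : (T - a) * F 0 = T * F 0 - a * F 0 by ring.
have e : - a * (s - F 0) = T * F 0 + (s - F 0).
  by rewrite opprK mulrDl mul1r divfK// gt_eqF.
have := F0 a; have TF := mulr_ge0 (ltW T0) (F0 a); lra.
Qed.

End ConcaveCrossing.

(** * Convex sets and their interiors *)

Section Convexity.
Context {R : realType} {d : nat}.
Local Notation E := 'rV[R]_d.
Implicit Types (A B : set E) (x y z u : E).

Lemma convex_comb A x y (l : R) : convex_set A -> 0 <= l <= 1 ->
  A x -> A y -> A ((1 - l) *: x + l *: y).
Proof.
move=> cA /andP[l0 l1] Ax Ay.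
have := cA y x (Itv01 l0 l1); rewrite !inE => /(_ Ay Ax).
by rewrite addrC.
Qed.

Lemma convex_of_comb A : (forall x y (l : R), 0 <= l <= 1 -> A x -> A y ->
  A ((1 - l) *: x + l *: y)) -> convex_set A.
Proof.
move=> h x y l; rewrite !inE => Ax Ay.
by rewrite /conv/= addrC; apply: h => //; rewrite ge0 le1.
Qed.

Lemma interior_normP A x :
  A° x <-> exists2 e, 0 < e & forall z, `|z| < e -> A (x + z).
Proof.
split.
  move=> /nbhs_ballP[e /= e0 eA]; exists e => // z ze; apply: eA.
  by rewrite -ball_normE /ball_ /= opprD addrA subrr sub0r normrN.
move=> [e e0 eA]; apply/nbhs_ballP; exists e => // y.
rewrite -ball_normE /ball_ /= => ye; rewrite -(subrK x y) addrC; apply: eA.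
by rewrite distrC.
Qed.

(** A homothety centred at [x] carries a ball around the interior point [p] to a ball inside [A], as
    close to [x] as desired. *)
Lemma convex_sub_closure_interior A : convex_set A -> A° !=set0 ->
  A `<=` closure A°.
Proof.
move=> cA [p /interior_normP[e e0 eA]] x Ax U /nbhs_ballP[r /= r0 rU].
pose q := 1 + `|p - x| + r.
have q0 : 0 < q by rewrite ltr_wpDl// addr_ge0.
pose l := r / q.
have l0 : 0 < l by rewrite divr_gt0.
have l1 : l <= 1 by rewrite ler_pdivrMr// mul1r lerDr addr_ge0.
exists ((1 - l) *: x + l *: p); split.
  apply/interior_normP; exists (l * e); first by rewrite mulr_gt0.
  move=> z ze.
  have -> : (1 - l) *: x + l *: p + z = (1 - l) *: x + l *: (p + l^-1 *: z).
    by rewrite scalerDr scalerA divff ?gt_eqF// scale1r addrA.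
  apply: convex_comb => //; first by rewrite ltW.
  by apply: eA; rewrite normrZ gtr0_norm ?invr_gt0// mulrC ltr_pdivrMr// mulrC.
apply: rU; rewrite -ball_normE /ball_ /=.
have -> : x - ((1 - l) *: x + l *: p) = l *: (x - p).
  by rewrite scalerBl scale1r scalerBr opprD opprB addrA addrCA subrr addr0.
rewrite normrZ gtr0_norm// distrC /l mulrAC ltr_pdivrMr// ltr_pM2l//.
by rewrite /q addrAC ltrDr ltr_wpDl.
Qed.

Lemma compact_norm_bound A : compact A ->
  exists2 M, 0 < M & forall x, A x -> `|x| <= M.
Proof.
move=> /compact_bounded/ex_strict_bound_gt0[M M0 MA].
by exists M => // x /MA/ltW.
Qed.

(** The direction leads from an interior point of [A] to a point outside. It is used to move a
    compact body off one part of the partition. *)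
Lemma escape_direction A B : convex_set A -> A° !=set0 -> A <> setT ->
  compact B -> exists w : E, exists2 b : R, 0 < b &
    forall x, B x -> ~ A (x + b *: w).
Proof.
move=> cA [p /interior_normP[e e0 eA]] AT cB.
have [x nAx] : exists x, ~ A x.
  by apply/existsNP => h; apply: AT; apply/seteqP; split.
have [M M0 MB] := compact_norm_bound _ cB.
(* Makes [c^-1 *: (p - k)] shorter than [e] for every [k] in [B]. *)
pose c := (`|p| + M) / e + 1.
have c0 : 0 < c by rewrite ltr_wpDl// divr_ge0 ?addr_ge0// ltW.
exists (x - p), (1 + c) => [|k Bk Ak]; first by rewrite addr_gt0.
(* The segment from a point of the ball around [p] to [k + (1 + c) w] passes
   through [x]. *)
have t0 : 0 < 1 + c by rewrite addr_gt0.
apply: nAx.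
have -> : x = (1 - (1 + c)^-1) *: (p + c^-1 *: (p - k)) +
    (1 + c)^-1 *: (k + (1 + c) *: (x - p)).
  apply/rowP => i; rewrite !mxE; field.
  by rewrite !gt_eqF.
apply: convex_comb => //.
  by rewrite invr_ge0 ltW//= invf_le1// lerDl ltW.
apply: eA; rewrite normrZ gtr0_norm ?invr_gt0// mulrC ltr_pdivrMr//.
rewrite mulrDr mulr1 mulrCA divff ?gt_eqF// mulr1.
rewrite (le_lt_trans (ler_normB _ _))// ltr_pwDr// lerD2l.
exact: MB.
Qed.

End Convexity.

(** * Admissible radii *)

Section Admissible.
Context {R : realType} {d : nat}.
Local Notation E := 'rV[R]_d.
Implicit Types (A B D : set E) (u x y z : E) (r s : R).

Lemma dotDr u x y : dot u (x + y) = dot u x + dot u y.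
Proof. by rewrite /dot linearD mulmxDr mxE. Qed.

Lemma dotZr u r x : dot u (r *: x) = r * dot u x.
Proof. by rewrite /dot linearZ -scalemxAr mxE. Qed.

Lemma dotC u x : dot u x = dot x u.
Proof. by rewrite /dot !mxE; apply: eq_bigr => i _; rewrite !mxE mulrC. Qed.

Lemma dotNr u x : dot u (- x) = - dot u x.
Proof. by rewrite -scaleN1r dotZr mulN1r. Qed.

Lemma dotBr u x y : dot u (x - y) = dot u x - dot u y.
Proof. by rewrite dotDr dotNr. Qed.

Lemma dot_continuous u : continuous (dot u).
Proof.
rewrite (_ : dot u = fun x => \sum_(i < d) u 0 i * x 0 i); last first.
  by apply/funext => x; rewrite /dot mxE; apply: eq_bigr => i _; rewrite mxE.
have ci i : continuous (fun x : E => u 0 i * x 0 i).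
  move=> x; apply: cvgMl_tmp; first exact: nbhs_filter.
  exact: coord_continuous.
by apply: continuous_big => [|i _]; [exact: add_continuous|exact: ci].
Qed.

Variables (C : set E) (m : nat).
Hypothesis neC : exists c1 c2, [/\ C c1, C c2 & c1 != c2].

Definition erosion A r : set E := [set t | homothet t r C `<=` A].

Lemma erosionP A r t : erosion A r t <-> forall c, C c -> A (t + r *: c).
Proof.
split => [h c Cc|h _ [c Cc <-]]; last exact: h.
by apply: h; exists c.
Qed.

(** Three sets are allowed because cuts of different translates of [K] get combined into the cut at
    an intermediate time. *)
Lemma erosion_comb A B D r s (l : R) x y :
  (forall a b, A a -> B b -> D ((1 - l) *: a + l *: b)) ->
  erosion A r x -> erosion B s y ->
  erosion D ((1 - l) * r + l * s) ((1 - l) *: x + l *: y).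
Proof.
move=> ABD /erosionP Ax /erosionP By; apply/erosionP => c Cc.
have -> : (1 - l) *: x + l *: y + ((1 - l) * r + l * s) *: c =
    (1 - l) *: (x + r *: c) + l *: (y + s *: c).
  by apply/rowP => i; rewrite !mxE; ring.
by apply: ABD; [exact: Ax|exact: By].
Qed.

Lemma homothet_interior t r : C° !=set0 -> 0 < r -> (homothet t r C)° !=set0.
Proof.
move=> [p /interior_normP[e e0 eC]] r0.
exists (t + r *: p); apply/interior_normP; exists (r * e); first exact: mulr_gt0.
move=> z ze; exists (p + r^-1 *: z).
  by apply: eC; rewrite normrZ gtr0_norm ?invr_gt0// mulrC ltr_pdivrMr// mulrC.
by rewrite scalerDr scalerA divff ?gt_eqF// scale1r addrA.
Qed.

Lemma interior_erosion A t : compact C -> A° t ->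
  exists2 r, 0 < r & erosion A r t.
Proof.
move=> /compact_norm_bound[M M0 MC] /interior_normP[e e0 eA].
have r0 : 0 < e / 2 / M by rewrite !divr_gt0.
exists (e / 2 / M) => //; apply/erosionP => c Cc; apply: eA.
rewrite normrZ gtr0_norm//.
apply: (@le_lt_trans _ _ (e / 2 / M * M)); first by rewrite ler_wpM2l ?MC// ltW.
by rewrite divfK ?gt_eqF// ltr_pdivrMr// ltr_pMr// ltr1n.
Qed.

(* In terms of the body [A ⊖ rC] of all [t] with [t + rC ⊂ A]: its C-width is
   at least [(m - 1) r]. Since [A^{rC} = (A ⊖ rC) + rC], this is equivalent to
   [w_C(A^{rC}) >= m r]. *)
Definition admissible A : set R := [set r | 0 <= r /\
  forall u, exists x y, [/\ erosion A r x, erosion A r y &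
    forall c c', C c -> C c' -> m.-1%:R * r * dot u (c - c') <= dot u (x - y)]].

Definition max_admissible A : R := sup (admissible A).

Lemma admissible0 A : A !=set0 -> admissible A 0.
Proof.
move=> [a Aa]; split => // u; exists a, a.
have Ea : erosion A 0 a by apply/erosionP => c _; rewrite scale0r addr0.
split => // c c' _ _; rewrite mulr0 mul0r subrr dotC.
by rewrite -(scale0r (0 : E)) dotC dotZr mul0r.
Qed.

(** The source of concavity: for each [u] the two pairs of witnesses are combined, and the width
    condition is linear in the radius and in [x - y]. *)
Lemma admissible_comb A B D r s (l : R) : 0 <= l <= 1 ->
  (forall a b, A a -> B b -> D ((1 - l) *: a + l *: b)) ->
  admissible A r -> admissible B s -> admissible D ((1 - l) * r + l * s).
Proof.
move=> /andP[l0 l1] ABD [r0 Ar] [s0 Bs].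
have l1' : 0 <= 1 - l by rewrite subr_ge0.
split; first by rewrite addr_ge0// mulr_ge0.
move=> u; have [x [y [Ex Ey xy]]] := Ar u; have [x' [y' [Ex' Ey' xy']]] := Bs u.
exists ((1 - l) *: x + l *: x'), ((1 - l) *: y + l *: y').
split; [exact: erosion_comb ABD Ex Ex'|exact: erosion_comb ABD Ey Ey'|].
move=> c c' Cc Cc'.
have -> : (1 - l) *: x + l *: x' - ((1 - l) *: y + l *: y') =
    (1 - l) *: (x - y) + l *: (x' - y').
  by rewrite opprD addrACA -!scalerBr.
rewrite [leRHS]dotDr 2!(dotZr u).
have := ler_wpM2l l1' (xy c c' Cc Cc').
have := ler_wpM2l l0 (xy' c c' Cc Cc'); lra.
Qed.

Lemma admissible_ubound A : compact A -> has_ubound (admissible A).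
Proof.
move=> /compact_norm_bound[M M0 MA]; have [c1 [c2 [Cc1 Cc2 c12]]] := neC.
have c0 : 0 < `|c1 - c2| by rewrite normr_gt0 subr_eq0.
(* The choice [u = 0] merely yields a translate of [r C] inside [A]; the images of [c1] and [c2] in
   it are at most [M + M] apart. *)
exists ((M + M) / `|c1 - c2|) => r [r0 /(_ 0)[x [_ [/erosionP Ex _ _]]]].
rewrite ler_pdivlMr// -{1}(ger0_norm r0) -normrZ.
have -> : r *: (c1 - c2) = (x + r *: c1) - (x + r *: c2).
  by rewrite scalerBr opprD addrACA subrr add0r.
by rewrite (le_trans (ler_normB _ _))// lerD// MA//; apply: Ex.
Qed.

(** For each [u], the radii together with their witnesses form a compact set [Z u], and the
    admissible radii are the intersection of the projections of these sets. *)
Lemma admissible_closed A : compact A -> closed (admissible A).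
Proof.
move=> cA; have clA : closed A by apply: compact_closed => //; exact: norm_hausdorff.
have [c0 [_ [Cc0 _ _]]] := neC.
have [M Mub] := admissible_ubound A cA.
pose p1 (p : R * (E * E)) := p.1.
pose p2 (p : R * (E * E)) := p.2.1.
pose p3 (p : R * (E * E)) := p.2.2.
have cp1 : continuous p1 by move=> ?; exact: cvg_fst.
have cp2 : continuous p2.
  by move=> p; apply: (@continuous_comp _ _ _ snd fst); [exact: cvg_snd|exact: cvg_fst].
have cp3 : continuous p3.
  by move=> p; apply: (@continuous_comp _ _ _ snd snd); exact: cvg_snd.
(* The two translation vectors of an admissible [r] are encoded by the images
   in [A] of the point [c0] of [C], so that the pairs range over [A * A]. *)
pose Z u := (`[0, M]%classic `*` (A `*` A)) `&`
  ((\bigcap_(c in C) ([set p | A (p2 p + p1 p *: (c - c0))] `&`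
                      [set p | A (p3 p + p1 p *: (c - c0))])) `&`
   (\bigcap_(c in C) \bigcap_(c' in C)
     [set p | dot u (p2 p - p3 p) - m.-1%:R * p1 p * dot u (c - c') >= 0])).
have cZ u : compact (Z u).
  apply: compact_closedI.
    by apply: compact_setX; [exact: segment_compact|exact: compact_setX].
  apply: closedI; apply: closed_bigI => c _.
    have clpre (q : R * (E * E) -> E) : continuous q ->
        closed [set p | A (q p + p1 p *: (c - c0))].
      move=> cq.
      apply: (@preimage_closed _ _ (fun p => q p + p1 p *: (c - c0)) A) => //.
      move=> p _; apply: cvgD; first exact: cq.
      by apply: cvgZr_tmp; exact: cp1.
    by apply: closedI; exact: clpre.
  apply: closed_bigI => c' _.
  apply: (@preimage_closed _ _
    (fun p => dot u (p2 p - p3 p) - m.-1%:R * p1 p * dot u (c - c'))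
    [set x | 0 <= x]); last exact: closed_ge.
  move=> p _; apply: cvgB.
    apply: (@continuous_comp _ _ _ (fun p => p2 p - p3 p) (dot u)).
      by apply: cvgB; [exact: cp2|exact: cp3].
    exact: dot_continuous.
  by apply: cvgMr_tmp; apply: cvgMl_tmp; exact: cp1.
have -> : admissible A = \bigcap_u (p1 @` Z u).
  apply/seteqP; split => [r Ar u _|r Zr].
    have r0 := Ar.1; have rM := Mub _ Ar; have [x [y [Ex Ey xy]]] := Ar.2 u.
    have shift z c : (z + r *: c0) + r *: (c - c0) = z + r *: c.
      by rewrite -addrA -scalerDr (addrC c0) subrK.
    move: Ex Ey => /erosionP Ex /erosionP Ey.
    exists (r, (x + r *: c0, y + r *: c0)) => //; split.
      by split; [rewrite /= in_itv/= r0|split; [exact: Ex|exact: Ey]].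
    split => c Cc; rewrite /p1 /p2 /p3 /=.
      by rewrite !shift; split; [exact: Ex|exact: Ey].
    by move=> c' Cc' /=; rewrite subr_ge0 opprD addrACA subrr addr0 xy.
  have r0 : 0 <= r.
    by have [p [[/= + _] _] <-] := Zr 0 Logic.I; rewrite in_itv => /andP[].
  split => // u; have [[r' [x y]] [_ [inA Zxy]] /= rE] := Zr u Logic.I.
  rewrite /p1 /p2 /p3 /= in rE inA Zxy; subst r'.
  exists (x - r *: c0), (y - r *: c0).
  have shift z c : z - r *: c0 + r *: c = z + r *: (c - c0).
    by rewrite -addrA scalerBr (addrC (- _)).
  split.
  - by apply/erosionP => c Cc; rewrite shift; have [] := inA c Cc.
  - by apply/erosionP => c Cc; rewrite shift; have [] := inA c Cc.
  - move=> c c' Cc Cc'; have /= := Zxy c Cc c' Cc'.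
    by rewrite subr_ge0 opprB addrA subrK.
apply: closed_bigI => u _; apply: compact_closed; first exact: norm_hausdorff.
by apply: continuous_compact => //; exact: continuous_subspaceT.
Qed.

Lemma max_admissibleP A : compact A -> A !=set0 ->
  admissible A (max_admissible A).
Proof.
move=> cA neA; have [M Mub] := admissible_ubound A cA.
have neS : admissible A !=set0 by exists 0; exact: admissible0.
have cS : compact (admissible A).
  apply: (subclosed_compact (admissible_closed A cA) (@segment_compact _ 0 M)).
  by move=> r Ar; rewrite /= in_itv/= Ar.1 Mub.
have [|T TS maxT] := compact_EVT_max (f := @idfun R) neS cS.
  by apply: continuous_subspaceT => x; exact: cvg_id.
rewrite inE in TS; suff -> : max_admissible A = T by [].
apply/eqP; rewrite eq_le; apply/andP; split.
  by apply: ge_sup => // r Ar; apply: maxT; rewrite inE.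
by apply: ub_le_sup => //; exists M.
Qed.

Lemma max_admissible_ub A r : compact A -> admissible A r ->
  r <= max_admissible A.
Proof. by move=> cA; apply: ub_le_sup; exact: admissible_ubound. Qed.

Lemma max_admissible_ge0 A : 0 <= max_admissible A.
Proof.
(* For an empty or unbounded set [sup] takes the default value 0. *)
rewrite /max_admissible; have [hs|/sup_out->//] := pselect (has_sup (admissible A)).
by have [[r Ar] ub] := hs; apply: le_trans Ar.1 _; exact: ub_le_sup.
Qed.

(** Restricts the test to positive radii, as [erosion_merge] requires; the supremum of the empty set
    is 0. *)
Lemma max_admissible_le A (x : R) : 0 <= x ->
  (forall r, 0 < r -> admissible A r -> r <= x) -> max_admissible A <= x.
Proof.
move=> x0 h; have [neS|nS] := pselect (admissible A !=set0).
  apply: ge_sup => // r Ar; have [r0|r0] := ltP 0 r; first exact: h.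
  exact: le_trans x0.
by rewrite /max_admissible sup_out// => -[].
Qed.

End Admissible.

(** * Sums over inductive partitions *)

Section Partition.
Context {R : realType} {d : nat}.
Local Notation E := 'rV[R]_d.
Implicit Types (A B K : set E).
Variables (C : set E) (m : nat).
Hypotheses (bodyC : convex_body C)
  (neC : exists c1 c2, [/\ C c1, C c2 & c1 != c2]).

Let sup_adm A := max_admissible C m A.

Lemma inductive_partition_closed n (V : 'I_n.+1 -> set E) i :
  inductive_partition V -> closed (V i) /\ convex_set (V i).
Proof.
case: n V i => [|n] V i /= => [VT|[[h _ _ _] _]]; last exact: h.
rewrite (ord1 i) VT; split; first exact: closedT.
by move=> x y l _ _; rewrite inE.
Qed.

Lemma inductive_partition_trivIset n (V : 'I_n.+1 -> set E) :
  inductive_partition V -> trivIset setT (fun i => (V i)°).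
Proof.
case: n V => [|n] V /= => [_|[[]//]].
by move=> i j _ _ _; rewrite (ord1 i) (ord1 j).
Qed.

(* The set [W_j \ V_j] lies in [V_i], since every other [V_k] has its interior in
   that of a part of [W] different from [W_j]. *)
Lemma erosion_merge n (V : 'I_n.+2 -> set E) (W : 'I_n.+1 -> set E) i j K r t :
  inductive_partition V -> inductive_partition W ->
  (forall j, V (lift i j) `<=` W j) -> (V i `&` K)° = set0 -> 0 < r ->
  erosion C (W j `&` K) r t -> erosion C (V (lift i j) `&` K) r t.
Proof.
move=> Vind Wind VW ViK r0 EW; have [[VclC Vint _ Vcov] _] := Vind.
have [_ convC intC] := bodyC; set T := homothet t r C in EW *.
have homK : T `<=` K by move=> x /EW[].
have cT : convex_set T.
  apply: convex_of_comb => x y l l01 [c Cc <-] [c' Cc' <-].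
  exists ((1 - l) *: c + l *: c'); first exact: convex_comb.
  by apply/rowP => k; rewrite !mxE; ring.
have intT : T° !=set0 by exact: homothet_interior.
suff TV : T° `<=` V (lift i j).
  move=> x Tx; split; last exact: homK.
  have [clV _] := VclC (lift i j); apply: clV.
  by apply: (closureS TV); exact: convex_sub_closure_interior.
move=> p Tp; apply: contrapT => nVp.
have oN : open (T° `&` ~` V (lift i j)).
  by apply: openI; [exact: open_interior|exact/closed_openC/(VclC _).1].
suff : T° `&` ~` V (lift i j) `<=` V i `&` K.
  by rewrite open_subsetE// ViK => /(_ p (conj Tp nVp)).
move=> q [Tq nVq]; split; last by apply: homK; exact: interior_subset.
have [k _ Vkq] : (\bigcup_i V i) q by rewrite Vcov.
case: (unliftP i k) => [k'|] kE; last by rewrite -kE.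
have k'j : k' <> j by move=> k'j; apply: nVq; rewrite -k'j -kE.
(* Near [q] the interior of [T] meets that of [V (lift i k')], hence that of [W k'], although [T]
   lies in [W j]. *)
rewrite kE in Vkq; have [_ convVk] := VclC (lift i k').
have [|s [Vks Ts]] := convex_sub_closure_interior _ convVk (Vint _) _ Vkq T°.
  by apply: open_nbhs_nbhs; split => //; exact: open_interior.
case: k'j; apply: (inductive_partition_trivIset _ _ Wind) => //.
exists s; split; first exact: (interiorS (VW k')).
by apply: (interiorS _ Ts) => x /EW[].
Qed.

Definition shift_set (v : E) A : set E := [set x + v | x in A].

Lemma shift_setP v A x : shift_set v A x <-> A (x - v).
Proof.
split => [[a Aa <-]|Ax]; first by rewrite addrK.
by exists (x - v) => //; rewrite subrK.
Qed.

Lemma shift_set_compact v A : compact A -> compact (shift_set v A).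
Proof.
move=> cA; apply: continuous_compact => //; apply: continuous_subspaceT.
move=> x; apply: cvgD; [exact: nbhs_filter|exact: cvg_id|].
by apply: cvg_cst; exact: nbhs_filter.
Qed.

Lemma shift_set_comb v w A x y (l : R) : convex_set A -> 0 <= l <= 1 ->
  shift_set v A x -> shift_set w A y ->
  shift_set ((1 - l) *: v + l *: w) A ((1 - l) *: x + l *: y).
Proof.
move=> cA l01 /shift_setP Ax /shift_setP Ay; apply/shift_setP.
have -> : (1 - l) *: x + l *: y - ((1 - l) *: v + l *: w) =
    (1 - l) *: (x - v) + l *: (y - w) by apply/rowP => i; rewrite !mxE; ring.
exact: convex_comb.
Qed.

Lemma shift_set_convex v A : convex_set A -> convex_set (shift_set v A).
Proof.
move=> cA; apply: convex_of_comb => x y l l01 [a Aa <-] [b Ab <-].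
exists ((1 - l) *: a + l *: b); first exact: convex_comb.
by apply/rowP => k; rewrite !mxE; ring.
Qed.

Lemma max_admissible_shift v A : sup_adm (shift_set v A) = sup_adm A.
Proof.
congr sup; apply/seteqP; split => r [r0 h]; split => // u.
  have [x [y [/erosionP Ex /erosionP Ey xy]]] := h u.
  exists (x - v), (y - v); split.
  - by apply/erosionP => c Cc; rewrite addrAC; apply/shift_setP/Ex.
  - by apply/erosionP => c Cc; rewrite addrAC; apply/shift_setP/Ey.
  - by move=> c c' Cc Cc'; rewrite opprB addrA subrK xy.
have [x [y [/erosionP Ex /erosionP Ey xy]]] := h u.
exists (x + v), (y + v); split.
- by apply/erosionP => c Cc; apply/shift_setP; rewrite addrAC addrK; exact: Ex.
- by apply/erosionP => c Cc; apply/shift_setP; rewrite addrAC addrK; exact: Ey.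
- by move=> c c' Cc Cc'; rewrite opprD addrACA subrr addr0 xy.
Qed.

(** These times are the projection of a closed set of pairs of a time and a point of [K]. Confining
    the time to an interval around [t] makes the set of pairs compact. *)
Lemma closed_meets_shift A K w : closed A -> compact K ->
  closed [set t : R | A `&` shift_set (t *: w) K !=set0].
Proof.
move=> clA cK; rewrite -openC openE => t /= nt.
pose q (p : R * E) := p.2 + p.1 *: w.
have cq : continuous q.
  move=> p; apply: cvgD; first exact: cvg_snd.
  by apply: cvgZr_tmp; exact: cvg_fst.
pose I := `[t - 1, t + 1]%classic : set R.
have clJ : closed (fst @` ((I `*` K) `&` q @^-1` A)).
  apply: compact_closed; first exact: Rhausdorff.
  apply: continuous_compact.
    by apply: continuous_subspaceT => p; exact: cvg_fst.
  apply: compact_closedI; first by apply: compact_setX => //; exact: segment_compact.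
  by apply: preimage_closed => // p _; exact: cq.
have nJ : (~` (fst @` ((I `*` K) `&` q @^-1` A))) t.
  move=> [[t' k] [[_ Kk] Aq] /= tE]; apply: nt; exists (k + t *: w).
  by split; [rewrite -tE|apply/shift_setP; rewrite addrK].
have nbJ := open_nbhs_nbhs (conj (closed_openC clJ) nJ).
have nbI : nbhs t I.
  apply/nbhs_ballP; exists 1 => //= s; rewrite /ball/= ltr_norml => ts.
  by rewrite /I/= in_itv/=; lra.
apply: filterS (filterI nbJ nbI) => s [nJs Is] [x [Ax /shift_setP Kx]].
apply: nJs; exists (s, x - s *: w) => //; split => //.
by rewrite /q/= subrK.
Qed.

(** A ball of radius [e] in the intersection at time [t] leaves one of radius [e / 2] at time [s]
    once [(t - s) *: w] is shorter than [e / 2]. *)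
Lemma open_interior_meets_shift A K w :
  open [set t : R | (A `&` shift_set (t *: w) K)° !=set0].
Proof.
rewrite openE => t [p /interior_normP[e e0 eA]].
apply/nbhs_ballP; pose q := e / 2 / (1 + `|w|).
have w0 : 0 < 1 + `|w| by rewrite ltr_wpDr.
exists q => /=; first by rewrite !divr_gt0.
move=> s; rewrite /ball/= => ts; exists p; apply/interior_normP.
exists (e / 2); first by rewrite divr_gt0.
have tsw : `|(t - s) *: w| < e / 2.
  rewrite normrZ; apply: (@le_lt_trans _ _ (`|t - s| * (1 + `|w|))).
    by rewrite ler_wpM2l// lerDr.
  by rewrite -ltr_pdivlMr.
move=> z ze; split.
  by apply: (eA _ _).1; rewrite (lt_trans ze)// ltr_pdivrMr// ltr_pMr// ltr1n.
apply/shift_setP.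
have [_ /shift_setP] : (A `&` shift_set (t *: w) K) (p + (z + (t - s) *: w)).
  by apply: eA; rewrite (le_lt_trans (ler_normD _ _))// (splitr e) ltrD.
rewrite (_ : p + _ - _ = p + z - s *: w)//.
by apply/rowP => i; rewrite !mxE; ring.
Qed.

Lemma sum_max_admissible n (V : 'I_n.+1 -> set E) K :
  inductive_partition V -> compact K -> convex_set K ->
  sup_adm K <= \sum_(i < n.+1) sup_adm (V i `&` K).
Proof.
elim: n V K => [|n IH] V K Vind cK convK.
  by rewrite big_ord_recl big_ord0 addr0 (Vind : V ord0 = setT) setTI.
have clVK i (L : set E) : compact L -> compact (V i `&` L).
  move=> cL; rewrite setIC; apply: compact_closedI => //.
  by have [] := inductive_partition_closed _ _ i Vind.
have degenerate (L : set E) : compact L -> convex_set L ->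
    (exists i, (V i `&` L)° = set0) ->
    sup_adm L <= \sum_(i < n.+2) sup_adm (V i `&` L).
  move=> cL convL [i ViL]; have [_ /(_ i)[W [Wind VW]]] := Vind.
  rewrite (bigD1_ord i)//= (le_trans (IH _ _ Wind cL convL))// ler_wpDl//.
    exact: max_admissible_ge0.
  apply: ler_sum => j _; apply: max_admissible_le; first exact: max_admissible_ge0.
  move=> r r0 [_ Wr]; apply: max_admissible_ub => //; first exact: clVK.
  split => [|u]; first exact: ltW.
  have [x [y [Ex Ey xy]]] := Wr u.
  by exists x, y; split => //;
    exact: (erosion_merge _ _ _ _ _ _ _ _ Vind Wind VW ViL r0).
have [[VclC Vint Vtriv _] _] := Vind.
(* There are at least two parts, and their interiors are nonempty and disjoint. *)
have V0T : V ord0 <> setT.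
  move=> V0; have [p Vp] := Vint ord_max.
  have := Vtriv ord0 ord_max Logic.I Logic.I; rewrite V0 interiorT setTI.
  by move=> /(_ (ex_intro _ _ Vp)) /(congr1 val).
have [w [b b0 wb]] :=
  escape_direction _ _ (VclC ord0).2 (Vint ord0) V0T cK.
pose L t := shift_set (t *: w) K.
pose bad := [set t | exists i, (V i `&` L t)° = set0].
pose F t := \sum_(i < n.+2) sup_adm (V i `&` L t).
have cL t : compact (L t) by exact: shift_set_compact.
have L0 : L 0 = K.
  apply/seteqP; split => [x /shift_setP|x Kx]; first by rewrite scale0r subr0.
  by apply/shift_setP; rewrite scale0r subr0.
have -> : \sum_(i < n.+2) sup_adm (V i `&` K) = F 0 by rewrite /F L0.
(* At the ends of an interval free of bad times a cut may lose its interior, but as a limit of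
   nonempty cuts it is nonempty, so its maximal radius is attained. *)
have meetsI i a c : a < c -> (forall t, a < t < c -> ~ bad t) ->
    V i `&` L a !=set0 /\ V i `&` L c !=set0.
  move=> ac nbad.
  have meets t : a < t < c -> V i `&` L t !=set0.
    move=> /nbad nb; apply: contrapT => nV; apply: nb; exists i.
    by apply/seteqP; split => // x Vx; apply: nV; exists x; exact: interior_subset.
  have clM := closed_meets_shift (V i) K w (VclC i).1 cK.
  pose h e : R := Num.min e (c - a) / 2.
  have hP e : 0 < e -> [/\ 0 < h e, h e < e & h e < c - a].
    move=> e0; have m0 : 0 < Num.min e (c - a) by rewrite lt_min e0 subr_gt0.
    have hm : h e < Num.min e (c - a) by rewrite /h ltr_pdivrMr// ltr_pMr// ltr1n.
    by split; [rewrite divr_gt0|apply: lt_le_trans hm _; rewrite ge_min lexx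
      |apply: lt_le_trans hm _; rewrite ge_min lexx orbT].
  split; apply: clM => U /nbhs_ballP[e /= e0 eU]; have [h0 he hc] := hP e e0.
    exists (a + h e); split; [apply: meets; lra|apply: eU].
    by rewrite /ball/= opprD addrA subrr sub0r normrN gtr0_norm.
  exists (c - h e); split; [apply: meets; lra|apply: eU].
  by rewrite /ball/= opprB addrC subrK gtr0_norm.
apply: (concave_crossing bad).
- rewrite (_ : bad = \bigcup_(i in setT) ~` [set t : R | (V i `&` L t)° !=set0]).
    apply: closed_bigcup; first exact: finite_finset.
    by move=> i _; apply: open_closedC; exact: open_interior_meets_shift.
  apply/seteqP; split => t [i]; [move=> Vi|move=> _ nVi]; exists i => //=.
    by rewrite Vi => -[].
  by apply/seteqP; split => // x Vx; apply: nVi; exists x.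
- by move=> t; apply: sumr_ge0 => i _; exact: max_admissible_ge0.
(* At a bad time [degenerate] applies to the translate, whose maximal radius is that of [K]. *)
- move=> t [i Vi]; rewrite -(max_admissible_shift (t *: w) K).
  by apply: degenerate; [exact: cL|exact: shift_set_convex|exists i].
- move=> a c l ac /andP[l0 l1] nbad; rewrite /F !mulr_sumr -big_split/=.
  apply: ler_sum => i _.
  have [neA neC'] := meetsI i _ _ ac nbad.
  apply: max_admissible_ub => //; first exact/clVK/cL.
  apply: (admissible_comb _ _ _ _ _ _ _ l); last 2 first.
  - by apply: max_admissibleP => //; exact/clVK/cL.
  - by apply: max_admissibleP => //; exact/clVK/cL.
  - by rewrite l0.
  move=> x y [Vx Lx] [Vy Ly]; split.
    by apply: convex_comb => //; [exact: (VclC i).2|rewrite l0].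
  rewrite /L (scalerDl w) -!scalerA; apply: shift_set_comb => //; by rewrite l0.
- exists b => //; exists ord0; apply/seteqP; split => // x /interior_subset[Vx].
  by move=> [k Kk kx]; apply: (wb k) => //; rewrite kx.
Qed.

End Partition.

(** * Width as the breadth of a linear functional *)

Section Breadth.
Context {R : realType} {d : nat}.
Local Notation E := 'rV[R]_d.
Implicit Types (A B C : set E) (u x y z : E).

Lemma dotNl u x : dot (- u) x = - dot u x.
Proof. by rewrite dotC dotNr dotC. Qed.

Lemma dotZl u x (r : R) : dot (r *: u) x = r * dot u x.
Proof. by rewrite dotC dotZr dotC. Qed.

Lemma dot_ge0 x : 0 <= dot x x.
Proof. by rewrite /dot mxE; apply: sumr_ge0 => i _; rewrite mxE -expr2 sqr_ge0. Qed.

Lemma dot_gt0 x : x != 0 -> 0 < dot x x.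
Proof.
move=> /rV0Pn[i xi]; rewrite /dot mxE (bigD1 i)//= mxE ltr_pwDl//.
  by rewrite lt_neqAle -expr2 sqr_ge0 eq_sym sqrf_eq0 xi.
by apply: sumr_ge0 => j _; rewrite mxE -expr2 sqr_ge0.
Qed.

Lemma enorm_gt0 x : x != 0 -> 0 < enorm x.
Proof. by move=> x0; rewrite sqrtr_gt0 dot_gt0. Qed.

Lemma sqr_enorm x : enorm x ^+ 2 = dot x x.
Proof. by rewrite sqr_sqrtr// dot_ge0. Qed.

(** Cauchy-Schwarz, from the nonnegative square of [dot u u *: x - dot u x *: u]. *)
Lemma dot_le_enorm u x : `|dot u x| <= enorm u * enorm x.
Proof.
have [->|u0] := eqVneq u 0.
  by rewrite -(scale0r (0 : E)) dotZl mul0r normr0 mulr_ge0 ?sqrtr_ge0.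
have uu := dot_gt0 u u0.
rewrite -(ler_pXn2r (n := 2))// ?nnegrE ?mulr_ge0 ?sqrtr_ge0//.
rewrite exprMn !sqr_enorm real_normK ?num_real//.
have := dot_ge0 (dot u u *: x - dot u x *: u).
rewrite !(dotBr, dotZr) !(dotC (_ - _)) !(dotBr, dotZr) (dotC x u).
rewrite (_ : _ - _ = dot u u * (dot u u * dot x x - dot u x ^+ 2)); last by ring.
by rewrite pmulr_rge0// subr_ge0.
Qed.

Lemma hyperplane_dist u (a b : R) : u != 0 ->
  set_dist (hyperplane u a) (hyperplane u b) = `|a - b| / enorm u.
Proof.
move=> u0; have uu := dot_gt0 u u0; have nu := enorm_gt0 u u0.
pose x (e : R) := (e / dot u u) *: u.
have xe e : dot u (x e) = e by rewrite dotZr divfK// gt_eqF.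
apply/eqP; rewrite eq_le; apply/andP; split.
  apply: ge_inf; first by exists 0 => _ [? _ [? _ <-]]; exact: sqrtr_ge0.
  exists (x a); first exact: xe.
  exists (x b); first exact: xe.
  rewrite -scalerBl -mulrBl /enorm dotZr dotZl mulrA -expr2 sqrtrM ?sqr_ge0//.
  rewrite sqrtr_sqr normrM normfV (gtr0_norm uu) -!mulrA; congr *%R.
  rewrite -[X in X^-1 * _]sqr_enorm -/(enorm u) expr2 invfM -mulrA mulVf ?mulr1//.
  by rewrite gt_eqF.
apply: lb_le_inf.
  by exists (enorm (x a - x b)), (x a); [exact: xe|exists (x b) => //; exact: xe].
move=> _ [y ya [z zb <-]]; rewrite ler_pdivrMr// mulrC -ya -zb -dotBr.
exact: dot_le_enorm.
Qed.

(** The functional [dot v] vanishes wherever [dot u] does, hence is a multiple of it. This is needed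
    because [supporting] leaves the equation of the hyperplane free. *)
Lemma hyperplane_inj u v (a b : R) : u != 0 -> v != 0 ->
  hyperplane u a = hyperplane v b ->
  exists2 k : R, k != 0 & (forall x, dot v x = k * dot u x) /\ b = k * a.
Proof.
move=> u0 v0 uv; have uu := dot_gt0 u u0.
pose p := (a / dot u u) *: u.
have up : dot u p = a by rewrite dotZr divfK// gt_eqF.
have vp : dot v p = b by rewrite -[_ = _]/(hyperplane v b p) -uv.
have par x : dot u x = 0 -> dot v x = 0.
  move=> ux; have : hyperplane v b (p + x) by rewrite -uv /hyperplane/= dotDr ux addr0.
  by rewrite /hyperplane/= dotDr vp; lra.
have vx x : dot v x = dot v u / dot u u * dot u x.
  have := par (x - (dot u x / dot u u) *: u).
  rewrite !dotBr !dotZr divfK ?gt_eqF// subrr => /(_ erefl) /eqP.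
  by rewrite subr_eq0 => /eqP ->; rewrite mulrAC [RHS]mulrAC [dot v u * _]mulrC.
exists (dot v u / dot u u); last by split => //; rewrite -vp vx up.
apply/eqP => k0; have := dot_gt0 v v0.
by rewrite vx k0 mul0r ltxx.
Qed.

(** The Euclidean width in direction [u] times [enorm u]; this factor cancels in relative widths. *)
Definition breadth B u : R := sup [set dot u (x - y) | x in B & y in B].

Lemma breadth_attained B u : compact B -> B !=set0 -> exists a b,
  [/\ B a, B b, forall x, B x -> dot u a <= dot u x <= dot u b &
      breadth B u = dot u b - dot u a].
Proof.
move=> cB neB; have cu : {within B, continuous (dot u)}.
  by apply: continuous_subspaceT; exact: dot_continuous.
have [a + amin] := compact_EVT_min neB cB cu.
have [b + bmax] := compact_EVT_max neB cB cu.
rewrite !inE => Bb Ba; exists a, b.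
have le x : B x -> dot u a <= dot u x <= dot u b.
  by move=> Bx; rewrite amin ?bmax// inE.
split => //; apply/eqP; rewrite eq_le; apply/andP.
have ub : ubound [set dot u (x - y) | x in B & y in B] (dot u b - dot u a).
  move=> _ [x Bx [y By <-]]; rewrite dotBr.
  by have /andP[_ ?] := le _ Bx; have /andP[? _] := le _ By; exact: lerB.
split.
  by apply: ge_sup => //; exists (dot u (b - a)), b => //; exists a.
apply: ub_le_sup; first by exists (dot u b - dot u a).
by exists b => //; exists a => //; rewrite dotBr.
Qed.

Lemma breadth_max B u x y : compact B -> B x -> B y ->
  dot u (x - y) <= breadth B u.
Proof.
move=> cB Bx By; have [|a [b [_ _ ab ->]]] := breadth_attained B u cB.
  by exists x.
by rewrite dotBr; have /andP[_ ?] := ab _ Bx; have /andP[? _] := ab _ By; exact: lerB.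
Qed.

Lemma breadth_gt0 B u : compact B -> B° !=set0 -> u != 0 -> 0 < breadth B u.
Proof.
move=> cB [p /interior_normP[e e0 eB]] u0.
have nu : 0 < `|u| by rewrite normr_gt0.
pose k := e / 2 / `|u|.
have k0 : 0 < k by rewrite !divr_gt0.
have Bk : B (p + k *: u).
  apply: eB; rewrite normrZ gtr0_norm// /k divfK ?gt_eqF//.
  by rewrite ltr_pdivrMr// ltr_pMr// ltr1n.
have Bp : B p by rewrite -(addr0 p); apply: eB; rewrite normr0.
apply: lt_le_trans (breadth_max B u _ _ cB Bk Bp).
by rewrite addrC addKr dotZr mulr_gt0// dot_gt0.
Qed.

Lemma parallel_hyperplane u (c : R) H : u != 0 -> parallel (hyperplane u c) H <->
  exists e, H = hyperplane u e.
Proof.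
move=> u0; have uu := dot_gt0 u u0.
have shift t : [set t + x | x in hyperplane u c] = hyperplane u (dot u t + c).
  apply/seteqP; split => [_ [x xc <-]|x xc]; first by rewrite /hyperplane/= dotDr xc.
  exists (x - t); last by rewrite addrC subrK.
  by rewrite /hyperplane/= dotBr xc addrC addKr.
split=> [[t ->]|[e ->]]; first by exists (dot u t + c); exact: shift.
by exists (((e - c) / dot u u) *: u); rewrite shift dotZr divfK ?gt_eqF// subrK.
Qed.

(** The supporting hyperplanes normal to [u] pass through a minimum and a maximum of [dot u] on [B].
    Positive breadth makes them distinct, so [xget] has exactly one candidate. *)
Lemma width_hyperplane B u (c : R) : compact B -> u != 0 -> 0 < breadth B u ->
  width B (hyperplane u c) = breadth B u / enorm u.
Proof.
move=> cB u0; have [->|/set0P neB] := eqVneq B set0.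
  rewrite /breadth (_ : [set _ | _ in _ & _ in _] = set0) ?sup0 ?ltxx//.
  by apply/seteqP; split => // _ [x []].
have [a [b [Ba Bb ab ->]]] := breadth_attained B u cB neB.
rewrite subr_gt0 => ltab.
have u0' : - u != 0 by rewrite oppr_eq0.
have supp e : supporting B (hyperplane u e) <-> e = dot u a \/ e = dot u b.
  split.
    move=> [[p [Bp pe]] [v [f [v0 uv vf]]]]; have /andP[ap pb] := ab _ Bp.
    have [k k0 [vk fk]] := hyperplane_inj u v e f u0 v0 uv.
    rewrite /hyperplane/= in pe.
    (* The sign of [k] tells on which side of the hyperplane [B] lies, thus whether [e] is the
       maximum or the minimum. *)
    have [k_gt0|k_lt0|k_eq0] := ltgtP 0 k; last by rewrite -k_eq0 eqxx in k0.
      right; apply/eqP; rewrite eq_le -{1}pe pb/=.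
      by have := vf _ Bb; rewrite vk fk ler_pM2l.
    left; apply/eqP; rewrite eq_le -{2}pe ap andbT.
    by have := vf _ Ba; rewrite vk fk ler_nM2l.
  case=> ->.
    split; first by exists a.
    exists (- u), (- dot u a); split => //.
      apply/seteqP; split => x; rewrite /hyperplane/= dotNl.
        by move=> ->.
      exact: oppr_inj.
    by move=> x /ab /andP[ax _]; rewrite dotNl lerN2.
  split; first by exists b.
  by exists u, (dot u b); split => // x /ab /andP[].
have inj e f : hyperplane u e = hyperplane u f -> e = f.
  move=> /(hyperplane_inj u u e f u0 u0)[k _ [/(_ u) uk ->]].
  have uu := dot_gt0 u u0.
  have -> : k = 1.
    by apply: (mulIf (x := dot u u)); [rewrite gt_eqF|rewrite mul1r -uk].
  by rewrite mul1r.
apply: xget_unique.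
  exists (hyperplane u (dot u a)), (hyperplane u (dot u b)); split.
  - split; first by apply/supp; left.
    by apply/parallel_hyperplane => //; exists (dot u a).
  - split; first by apply/supp; right.
    by apply/parallel_hyperplane => //; exists (dot u b).
  - by move/inj => eab; rewrite eab ltxx in ltab.
  - by rewrite hyperplane_dist// distrC gtr0_norm// subr_gt0.
move=> w [H1 [H2 [[s1 p1] [s2 p2] H12 ->]]].
have [e eE] := (parallel_hyperplane u c H1 u0).1 p1.
have [f fE] := (parallel_hyperplane u c H2 u0).1 p2.
move: s1 s2 H12; rewrite eE fE hyperplane_dist// => /supp + /supp.
move=> [] -> [] -> // _; congr (_ / _); last by rewrite gtr0_norm// subr_gt0.
by rewrite distrC gtr0_norm// subr_gt0.
Qed.

Lemma min_rel_width_ge (C B : set E) (l : R) : (0 < d)%N ->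
  compact C -> C° !=set0 -> compact B -> B° !=set0 ->
  l <= min_rel_width C B <->
  forall u, u != 0 -> l * breadth C u <= breadth B u.
Proof.
move=> d0 cC iC cB iB.
have relE u c : u != 0 -> rel_width C B (hyperplane u c) = breadth B u / breadth C u.
  move=> u0; rewrite /rel_width !width_hyperplane ?breadth_gt0//.
  have nu := enorm_gt0 u u0; have bC := breadth_gt0 C u cC iC u0.
  by field; rewrite !gt_eqF.
have lb : lbound [set rel_width C B H | H in @is_hyperplane R d] 0.
  move=> _ [_ [u [c [u0 ->]]] <-]; rewrite relE//.
  by rewrite divr_ge0// ltW// breadth_gt0.
split=> [h u u0|h].
  rewrite -ler_pdivlMr ?breadth_gt0//; apply: le_trans h _; apply: ge_inf.
    by exists 0.
  by exists (hyperplane u 0); [exists u, 0|exact: relE].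
apply: lb_le_inf.
  (* As [0 < d], some hyperplane exists and the infimum is over a nonempty set. *)
  have u0 : const_mx 1 != 0 :> E.
    by apply/rV0Pn; exists (Ordinal d0); rewrite mxE oner_neq0.
  exists (rel_width C B (hyperplane (const_mx 1) 0)), (hyperplane (const_mx 1) 0) => //.
  by exists (const_mx 1), 0.
move=> _ [_ [u [c [u0 ->]]] <-]; rewrite relE// ler_pdivlMr ?breadth_gt0//.
exact: h.
Qed.

(** Iterated midpoints: the sum gives the point halfway between [x + v ord0] and the point built
    from the remaining vectors. *)
Lemma halving_sum B x k (v : 'I_k -> E) : convex_set B -> B x ->
  (forall i, B (x + v i)) -> B (x + \sum_(i < k) 2^-1 ^+ i.+1 *: v i).
Proof.
move=> cB Bx; elim: k v => [|k IH] v Bv; first by rewrite big_ord0 addr0.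
have Bs := IH _ (fun i => Bv (lift ord0 i)).
have := convex_comb B (x + v ord0) _ 2^-1 cB _ (Bv ord0) Bs.
rewrite big_ord_recl expr1.
have -> : \sum_(i < k) 2^-1 ^+ (lift ord0 i).+1 *: v (lift ord0 i) =
    2^-1 *: \sum_(i < k) 2^-1 ^+ i.+1 *: v (lift ord0 i) :> E.
  by rewrite scaler_sumr; apply: eq_bigr => i _; rewrite scalerA -exprS.
set s := \sum_(_ < _) _.
have -> : (1 - 2^-1) *: (x + v ord0) + 2^-1 *: (x + s) =
  x + (2^-1 *: v ord0 + 2^-1 *: s) by apply/rowP => i; rewrite !mxE; field.
by apply; rewrite invr_ge0 ler0n invf_le1// ler1n.
Qed.

(** There are [d] independent vectors leading from [a] to points of [B], and by convexity [B]
    contains a small parallelepiped with vertex [a] spanned by them. *)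
Lemma convex_interior B : convex_set B -> B !=set0 ->
  (forall u, u != 0 -> exists x y, [/\ B x, B y & dot u (x - y) != 0]) ->
  B° !=set0.
Proof.
move=> cB [a Ba] wide.
have [M Mfree BM] : exists2 M : 'M[R]_d, row_free M & forall i, B (a + row i M).
  suff H k : (k <= d)%N ->
      exists2 M : 'M[R]_(k, d), row_free M & forall i, B (a + row i M) by exact: H.
  elim: k => [_|k IH kd].
    by exists 0 => [|[]//]; rewrite /row_free mxrank0.
  have [M Mfree BM] := IH (ltnW kd).
  (* A functional vanishing on the rows found so far is not constant on [B], which gives a new
     independent row. *)
  have [u u0 Mu] : exists2 u : E, u != 0 & M *m u^T = 0.
    have : kermx M^T != 0.
      by rewrite kermx_eq0 /row_free mxrank_tr (eqP Mfree) ltn_eqF.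
    move=> /rowV0Pn[u /sub_kermxP uM u0]; exists u => //.
    by apply: trmx_inj; rewrite trmx_mul trmxK uM trmx0.
  have [z Bz uz] : exists2 z, B z & dot u (z - a) != 0.
    have [x [y [Bx By xy]]] := wide u u0.
    have [xa|xa] := eqVneq (dot u (x - a)) 0; last by exists x.
    exists y => //; apply: contra_neq xy => ya.
    by move: xa ya; rewrite !dotBr; lra.
  suff [M' ? ?] : exists2 M' : 'M[R]_(1 + k, d), row_free M' &
      forall i, B (a + row i M') by exists M'.
  exists (col_mx (z - a) M); last first.
    move=> i; case: (split_ordP i) => j ->.
      by rewrite rowKu ord1 row_id addrC subrK.
    by rewrite rowKd.
  apply: inj_row_free => w; rewrite -[w]hsubmxK mul_row_col => w0.
  have w1 : lsubmx w = 0.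
    have := congr1 (mulmx^~ u^T) w0.
    rewrite mulmxDl -!mulmxA Mu mulmx0 addr0 mul0mx => /rowP/(_ 0).
    rewrite !mxE big_ord1.
    rewrite -/(dot (z - a) u) dotC => /eqP; rewrite mulf_eq0 (negPf uz) orbF.
    by move=> /eqP l0; apply/rowP => i; rewrite ord1 l0 mxE.
  move: w0; rewrite w1 mul0mx add0r => w2.
  by rewrite (row_free_inj Mfree (etrans w2 (esym (mul0mx _ _)))) row_mx0.
have Munit : M \in unitmx by rewrite -row_free_unit.
(* [S] dominates the absolute column sums of [N], so a [z] shorter than [h / S] has coordinates at
   most [h] with respect to the rows of [M]. The centre [h] is half of the side [2^-1 ^+ d] of the
   cube of coordinates. *)
pose N := invmx M; pose S := 1 + \sum_i \sum_j `|N i j|.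
have S0 : 0 < S.
  by rewrite ltr_wpDr//; do 2!apply: sumr_ge0 => ? _.
pose h : R := 2^-1 ^+ d.+1.
have h0 : 0 < h by rewrite exprn_gt0// invr_gt0.
exists (a + const_mx h *m M); apply/interior_normP; exists (h / S).
  exact: divr_gt0.
move=> z zh; pose t := const_mx h + z *m N.
have -> : a + const_mx h *m M + z = a + t *m M.
  by rewrite /t mulmxDl mulmxKV// addrA.
have tb j : 0 <= t 0 j <= 2^-1 ^+ d.
  have zN : `|(z *m N) 0 j| <= h.
    rewrite mxE (le_trans (ler_norm_sum _ _ _))//.
    apply: (@le_trans _ _ (`|z| * \sum_i \sum_j `|N i j|)).
      rewrite mulr_sumr; apply: ler_sum => i _; rewrite normrM ler_pM//.
        rewrite [leRHS]/Num.norm/= mx_normrE.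
        exact: (le_bigmax _ (fun ij => `|z ij.1 ij.2|) (0, i)).
      by rewrite (bigD1 j)//= lerDl sumr_ge0.
    apply: (@le_trans _ _ (`|z| * S)); first by rewrite ler_wpM2l// lerDr.
    by rewrite -ler_pdivlMr// ltW.
  have -> : 2^-1 ^+ d = h + h by rewrite /h exprS; lra.
  by move: zN; rewrite !mxE ler_norml; lra.
(* Prepares [halving_sum]: the factor [2 ^+ j.+1 * t 0 j] is at most 1 because [j < d]. *)
have -> : t *m M = \sum_(j < d) 2^-1 ^+ j.+1 *: ((2 ^+ j.+1 * t 0 j) *: row j M).
  rewrite mulmx_sum_row; apply: eq_bigr => j _.
  by rewrite scalerA mulrA -exprMn mulVf ?expr1n ?mul1r ?pnatr_eq0.
apply: halving_sum => // j.
have -> : a + (2 ^+ j.+1 * t 0 j) *: row j M =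
    (1 - 2 ^+ j.+1 * t 0 j) *: a + (2 ^+ j.+1 * t 0 j) *: (a + row j M).
  by apply/rowP => i; rewrite !mxE; ring.
have /andP[t0 t1] := tb j; apply: convex_comb => //.
rewrite mulr_ge0 ?exprn_ge0//=.
apply: (@le_trans _ _ (2 ^+ j.+1 * 2^-1 ^+ d)); first by rewrite ler_wpM2l// exprn_ge0.
rewrite exprVn ler_pdivrMr ?exprn_gt0// mul1r.
by rewrite ler_eXn2l ?ltr1n.
Qed.

End Breadth.

(** * The successive inradius as the largest admissible radius *)

Section SuccessiveInradius.
Context {R : realType} {d : nat}.
Local Notation E := 'rV[R]_d.
Implicit Types (A : set E) (u x y t : E) (r s : R).
Hypothesis d_gt0 : (0 < d)%N.
Variable C : set E.
Hypothesis bodyC : convex_body C.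

Let cC : compact C. Proof. by case: bodyC. Qed.
Let convC : convex_set C. Proof. by case: bodyC. Qed.
Let intC : C° !=set0. Proof. by case: bodyC. Qed.

Let neC : C !=set0.
Proof. by have [p /interior_subset Cp] := intC; exists p. Qed.

Lemma body_two_points : exists c1 c2, [/\ C c1, C c2 & c1 != c2].
Proof.
have u0 : const_mx 1 != 0 :> E.
  by apply/rV0Pn; exists (Ordinal d_gt0); rewrite mxE oner_neq0.
have [a [b [Ca Cb _ bE]]] := breadth_attained C (const_mx 1) cC neC.
exists a, b; split => //; apply/eqP => ab.
by have := breadth_gt0 C _ cC intC u0; rewrite bE ab subrr ltxx.
Qed.

(** The translate [t + sC] is shrunk towards its point [t + s c]. Varying [c] shows that [A ⊖ rC]
    contains [(A ⊖ sC) + (s - r)C]. *)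
Lemma erosion_shrink A r s t c : C c -> 0 <= r <= s -> 0 < s ->
  erosion C A s t -> erosion C A r (t + (s - r) *: c).
Proof.
move=> Cc /andP[r0 rs] s0 /erosionP At; apply/erosionP => c' Cc'.
have -> : t + (s - r) *: c + r *: c' =
    t + s *: ((1 - r / s) *: c + (r / s) *: c').
  by apply/rowP => i; rewrite !mxE; field; rewrite gt_eqF.
apply: At; apply: convex_comb => //.
by rewrite divr_ge0// ?(ltW s0)//= ler_pdivrMr// mul1r.
Qed.

Lemma erosion_compact A r : compact A -> compact (erosion C A r).
Proof.
move=> cA; have [c0 Cc0] := neC.
have clA : closed A by apply: compact_closed => //; exact: norm_hausdorff.
have [M M0 MA] := compact_norm_bound A cA.
apply: bounded_closed_compact.
  exists (M + `|r *: c0|); split; first exact: num_real.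
  move=> x xM t /erosionP/(_ _ Cc0)/MA tM; apply: le_trans (ltW xM).
  by rewrite -[t](addrK (r *: c0)) (le_trans (ler_normB _ _))// lerD2r.
rewrite (_ : erosion C A r = \bigcap_(c in C) [set t | A (t + r *: c)]).
  apply: closed_bigI => c _.
  apply: (@preimage_closed _ _ (fun t : E => t + r *: c) A) => // t _.
  by apply: cvgD; [exact: nbhs_filter|exact: cvg_id|apply: cvg_cst; exact: nbhs_filter].
by apply/seteqP; split => t /erosionP.
Qed.

Lemma rounded_bodyE A r :
  rounded_body C r A = [set p.1 + r *: p.2 | p in erosion C A r `*` C].
Proof.
apply/seteqP; split => [x [t Et [c Cc <-]]|_ [[t c] [/= Et Cc] <-]].
  by exists (t, c).
by exists t => //; exists c.
Qed.

Lemma rounded_body_compact A r : compact A -> compact (rounded_body C r A).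
Proof.
move=> cA; rewrite rounded_bodyE; apply: continuous_compact.
  apply: continuous_subspaceT => p; apply: cvgD; first exact: cvg_fst.
  by apply: cvgZl_tmp; exact: cvg_snd.
by apply: compact_setX => //; exact: erosion_compact.
Qed.

Lemma rounded_body_interior A r : 0 < r -> erosion C A r !=set0 ->
  (rounded_body C r A)° !=set0.
Proof.
move=> r0 [t Et]; apply: subset_nonempty (homothet_interior C t r intC r0).
by apply: interiorS => x Tx; exists t.
Qed.

(** In the Minkowski sum of the erosion and [rC], the extreme points of the two summands can be
    chosen independently. *)
Lemma breadth_rounded_body A r u : compact A -> 0 <= r ->
  erosion C A r !=set0 ->
  breadth (rounded_body C r A) u = breadth (erosion C A r) u + r * breadth C u.
Proof.
move=> cA r0 neE; have cE := erosion_compact A r cA.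
have cR := rounded_body_compact A r cA.
apply/eqP; rewrite eq_le; apply/andP; split.
  have [|_ [_ [[t Et [c Cc <-]] [t' Et' [c' Cc' <-]] _ ->]]] :=
      breadth_attained (rounded_body C r A) u cR.
    have [t Et] := neE; have [c Cc] := neC.
    by exists (t + r *: c), t => //; exists c.
  have := breadth_max _ u _ _ cE Et' Et.
  have := ler_wpM2l r0 (breadth_max _ u _ _ cC Cc' Cc).
  by rewrite !dotDr !dotZr !dotNr; lra.
have [t [t' [Et Et' _ ->]]] := breadth_attained _ u cE neE.
have [c [c' [Cc Cc' _ ->]]] := breadth_attained _ u cC neC.
have R1 : rounded_body C r A (t' + r *: c') by exists t' => //; exists c'.
have R2 : rounded_body C r A (t + r *: c) by exists t => //; exists c.
have := breadth_max _ u _ _ cR R1 R2.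
by rewrite !dotBr !dotDr !dotZr; lra.
Qed.

Lemma min_rel_width_rounded_ge A r (l : R) : compact A -> 0 < r ->
  erosion C A r !=set0 ->
  l + r <= min_rel_width C (rounded_body C r A) <->
  forall u, u != 0 -> l * breadth C u <= breadth (erosion C A r) u.
Proof.
move=> cA r0 neE; rewrite min_rel_width_ge//; last 2 first.
- exact: rounded_body_compact.
- exact: rounded_body_interior.
split=> h u /h; rewrite breadth_rounded_body// ?(ltW r0)//.
  by rewrite mulrDl lerD2r.
by rewrite mulrDl lerD2r.
Qed.

(** Extreme points of the compact erosion in direction [u] serve as witnesses; for [u = 0] any point
    does. *)
Lemma admissibleE m A r : compact A -> admissible C m A r <->
  [/\ 0 <= r, erosion C A r !=set0 & forall u, u != 0 ->
      m.-1%:R * r * breadth C u <= breadth (erosion C A r) u].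
Proof.
move=> cA; have cE := erosion_compact A r cA; split.
  move=> [r0 h]; split => // [|u _].
    by have [x [_ [Ex _ _]]] := h 0; exists x.
  have [x [y [Ex Ey]]] := h u.
  have [a [b [Ca Cb _ ->]]] := breadth_attained _ u cC neC.
  by move=> /(_ _ _ Cb Ca); rewrite -dotBr => /le_trans; apply; exact: breadth_max.
move=> [r0 neE h]; split => // u.
have [->|/h] := eqVneq u 0.
  have [x Ex] := neE; exists x, x; split => // c c' _ _.
  by rewrite -(scale0r (0 : E)) !dotZl !mul0r mulr0.
have [x [y [Ex Ey _ ->]]] := breadth_attained _ u cE neE.
rewrite -dotBr => hu; exists y, x; split => // c c' Cc Cc'; apply: le_trans hu.
by rewrite ler_wpM2l ?mulr_ge0//; exact: breadth_max.
Qed.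

(** For [m = 1] the width condition is vacuous; this makes the results on maximal admissible radii
    available for the inradius. *)
Lemma admissible1 A r : compact A -> 0 <= r -> erosion C A r !=set0 ->
  admissible C 1 A r.
Proof.
move=> cA r0 neE; apply/admissibleE => //; split => // u u0.
have [t Et] := neE; rewrite mul0r mul0r -(subrr (dot u t)) -dotBr.
by apply: breadth_max => //; exact: erosion_compact.
Qed.

Lemma inradius_erosion A r : compact A -> A !=set0 -> 0 < r <= inradius C A ->
  erosion C A r !=set0.
Proof.
move=> cA neA /andP[r0 rin].
have [s0 _] := max_admissibleP C 1 body_two_points A cA neA.
have /admissibleE[//|_ [t Et] _] := max_admissibleP C 1 body_two_points A cA neA.
have rs : r <= max_admissible C 1 A.
  apply: le_trans rin _; rewrite /inradius.
  have [neS|nS] := pselect ([set r | 0 < r /\ exists t, homothet t r C `<=` A] !=set0).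
    apply: ge_sup => // q [q0 [t' Et']].
    apply: max_admissible_ub => //; first exact: body_two_points.
    by apply: admissible1 => //; [exact: ltW|exists t'].
  by rewrite sup_out// => -[].
have [c Cc] := neC; exists (t + (max_admissible C 1 A - r) *: c).
by apply: erosion_shrink => //; rewrite ?(ltW r0)//; exact: lt_le_trans rs.
Qed.

Variable m : nat.
Hypothesis m_gt0 : (0 < m)%N.

Let mE r : m%:R * r = m.-1%:R * r + r.
Proof. by rewrite -{1}(prednK m_gt0) -natr1 mulrDl mul1r. Qed.

(* If all C-widths of [A ⊖ sC] exceed [(m - 1) s] by [q], then [A ⊖ sC] contains
   a translate of some [eC], and moving all of [A ⊖ sC] slightly towards the
   corresponding point [t] produces an admissible number larger than [s]. *)
Lemma max_admissible_tight A (q : R) (s := max_admissible C m A) :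
  compact A -> convex_set A -> A !=set0 -> 0 < q ->
  ~ forall u, u != 0 -> (m.-1%:R * s + q) * breadth C u <= breadth (erosion C A s) u.
Proof.
move=> cA convA neA q0 wide.
have /admissibleE[//|s0 neE _] := max_admissibleP C m body_two_points A cA neA.
rewrite -/s in s0 neE; have cE := erosion_compact A s cA.
have m0 : 0 <= m.-1%:R :> R by [].
have [t Et0] : (erosion C A s)° !=set0.
  apply: convex_interior => //.
    apply: convex_of_comb => x y l l01 Ex Ey.
    have comb a b := convex_comb A a b l convA l01.
    have := erosion_comb C A A A s s l x y comb Ex Ey.
    by rewrite -mulrDl subrK mul1r.
  move=> u u0; have [x [y [Ex Ey _ b]]] := breadth_attained _ u cE neE.
  exists y, x; split => //; rewrite dotBr -b gt_eqF//.
  apply: lt_le_trans (wide u u0).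
  by rewrite mulr_gt0 ?breadth_gt0// ltr_wpDl// mulr_ge0.
have [f f0 /erosionP Ef] := interior_erosion C _ t cC Et0.
(* A translate [t + fC] inside [A ⊖ sC] puts [t + (s + f)C] inside [A]. *)
have Et : erosion C A (s + f) t.
  apply/erosionP => c Cc; rewrite scalerDl (addrC (s *: c)) addrA.
  by have /erosionP := Ef c Cc; apply.
(* The weight [l = q / k] solves [(m - 1) ((1 - l) s + l (s + f)) = (1 - l) ((m - 1) s + q)]: the
   gap [q] pays exactly for the contraction by [1 - l]. *)
pose k := q + m.-1%:R * (s + f).
have k0 : 0 < k by rewrite ltr_wpDr// mulr_ge0// addr_ge0// ltW.
pose l := q / k.
have l0 : 0 < l by rewrite divr_gt0.
have l1 : l <= 1.
  by rewrite ler_pdivrMr// mul1r lerDl mulr_ge0// addr_ge0// ltW.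
have l01 : 0 <= l <= 1 by rewrite ltW.
have comb a b := convex_comb A a b l convA l01.
have : admissible C m A ((1 - l) * s + l * (s + f)).
  apply/admissibleE => //; split.
  - by rewrite addr_ge0// mulr_ge0// ?subr_ge0 ?addr_ge0// ltW.
  - have [x Ex] := neE; exists ((1 - l) *: x + l *: t).
    exact: erosion_comb comb Ex Et.
  move=> u u0; have [x [y [Ex Ey _ b]]] := breadth_attained _ u cE neE.
  have Ex' := erosion_comb C A A A _ _ l _ _ comb Ex Et.
  have Ey' := erosion_comb C A A A _ _ l _ _ comb Ey Et.
  apply: le_trans (breadth_max _ u _ _ (erosion_compact A _ cA) Ey' Ex').
  have -> : (1 - l) *: y + l *: t - ((1 - l) *: x + l *: t) = (1 - l) *: (y - x).
    by apply/rowP => i; rewrite !mxE; ring.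
  rewrite dotZr dotBr -b; apply: (@le_trans _ _ ((1 - l) *
      ((m.-1%:R * s + q) * breadth C u))); last first.
    by rewrite ler_wpM2l ?subr_ge0//; exact: wide.
  rewrite (_ : m.-1%:R * ((1 - l) * s + l * (s + f)) =
      (1 - l) * (m.-1%:R * s + q)) ?mulrA//.
  by rewrite /l /k; field; rewrite gt_eqF.
move=> /(max_admissible_ub C m body_two_points A _ cA); rewrite -/s.
have := mulr_gt0 l0 f0; lra.
Qed.

(** If [p + rC] lies in [A], the translates of [(r / m)C] inside it have among their centres a
    translate of [(m - 1) (r / m)C], which has the required width. *)
Lemma max_admissible_gt0 A : compact A -> A° !=set0 -> 0 < max_admissible C m A.
Proof.
move=> cA [p Ap]; have [r r0 Ep] := interior_erosion C A p cC Ap.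
have m0 : 0 < m%:R :> R by rewrite ltr0n.
apply: (@lt_le_trans _ _ (r / m%:R)); first by rewrite divr_gt0.
apply: max_admissible_ub => //; first exact: body_two_points.
have rm : 0 <= r / m%:R <= r.
  by rewrite divr_ge0 ?(ltW r0)//= ler_pdivrMr// ler_peMr ?ler1n// ltW.
apply/admissibleE => //; split; first by case/andP: rm.
  by have [c Cc] := neC; exists (p + (r - r / m%:R) *: c); exact: erosion_shrink.
move=> u u0; have [a [b [Ca Cb _ ->]]] := breadth_attained _ u cC neC.
have Ea := erosion_shrink A _ _ _ _ Ca rm r0 Ep.
have Eb := erosion_shrink A _ _ _ _ Cb rm r0 Ep.
have := breadth_max _ u _ _ (erosion_compact A _ cA) Eb Ea.
rewrite dotBr !dotDr !dotZr opprD addrACA subrr add0r -mulrBr.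
suff -> : m.-1%:R * (r / m%:R) = r - r / m%:R by [].
by have := mE (r / m%:R); rewrite mulrCA divff ?gt_eqF// mulr1; lra.
Qed.

(** At the largest admissible radius [s] equality holds by [max_admissible_tight]. Any root [r] is
    admissible, so [r <= s]; and [r < s] would give [A^{rC}] a C-width of at least [m s > m r]. *)
Lemma succ_inradiusE A : convex_body A ->
  succ_inradius C A m = max_admissible C m A.
Proof.
move=> [cA convA intA]; have neA : A !=set0.
  by have [p /interior_subset Ap] := intA; exists p.
have s0 := max_admissible_gt0 A cA intA.
have Hs := max_admissibleP C m body_two_points A cA neA.
have /admissibleE[//|_ neE wE] := Hs.
have tight q := max_admissible_tight A q cA convA neA.
set s := max_admissible C m A in s0 Hs neE wE tight *.
apply: xget_unique => [|r [/andP[r0 rin] rE]].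
  split.
    rewrite s0 /inradius; apply: ub_le_sup; last first.
      by have [t Et] := neE; split => //; exists t.
    have [M Mub] := admissible_ubound C 1 body_two_points A cA.
    exists M => q [q0 [t Et]]; apply/Mub/admissible1 => //; first exact: ltW.
    by exists t.
  rewrite mE; apply/eqP; rewrite eq_le; apply/andP; split; last first.
    exact/min_rel_width_rounded_ge.
  rewrite leNgt; apply/negP => lt.
  pose q := min_rel_width C (rounded_body C s A) - (m.-1%:R * s + s).
  apply: (tight q); first by rewrite subr_gt0.
  by apply/min_rel_width_rounded_ge => //; rewrite /q; lra.
have nEr : erosion C A r !=set0 by apply: inradius_erosion => //; rewrite r0.
apply/eqP; rewrite eq_le; apply/andP; split.
  apply: max_admissible_ub => //; first exact: body_two_points.
  apply/admissibleE => //; split => //; first exact: ltW.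
  by apply/min_rel_width_rounded_ge => //; rewrite -mE rE.
rewrite leNgt; apply/negP => rs.
have : m%:R * s - r + r <= min_rel_width C (rounded_body C r A).
  apply/min_rel_width_rounded_ge => // u u0.
  have [x [y [Ex Ey _ bE]]] := breadth_attained _ u (erosion_compact A s cA) neE.
  have [c [c' [Cc Cc' _ bC]]] := breadth_attained _ u cC neC.
  have rs' : 0 <= r <= s by rewrite !ltW.
  have Ex' := erosion_shrink A _ _ _ _ Cc rs' s0 Ex.
  have Ey' := erosion_shrink A _ _ _ _ Cc' rs' s0 Ey.
  have := breadth_max _ u _ _ (erosion_compact A r cA) Ey' Ex'.
  have := wE u u0; rewrite bE bC !dotBr !dotDr !dotZr mE; lra.
by rewrite subrK rE ler_pM2l ?ltr0n// leNgt rs.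
Qed.

End SuccessiveInradius.

Theorem theorem2p2 (R : realType) (d : nat) (d_ge2 : (2 <= d)%N)
    (K C : set 'rV[R]_d) (bodyK : convex_body K) (bodyC : convex_body C)
    (m : nat) (m_gt0 : (0 < m)%N)
    (n : nat) (V : 'I_n.+1 -> set 'rV[R]_d)
    (partV : inductive_partition V)
    (intVK : forall i, (V i `&` K)° !=set0) :
  \sum_(i < n.+1) succ_inradius C (V i `&` K) m >= succ_inradius C K m.
Proof.
have d_gt0 : (0 < d)%N by exact: leq_trans d_ge2.
have [cK convK _] := bodyK.
(* The hypothesis on interiors enters here, so that [succ_inradiusE] applies to every cut. *)
have bodyVK i : convex_body (V i `&` K).
  have [clV convV] := inductive_partition_closed n V i partV.
  split=> //; first by rewrite setIC; exact: compact_closedI.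
  apply: convex_of_comb => x y l l01 [Vx Kx] [Vy Ky].
  by split; exact: convex_comb.
rewrite succ_inradiusE//; under eq_bigr do rewrite succ_inradiusE//.
by apply: sum_max_admissible => //; exact: body_two_points.
Qed.
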